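(* Let $k\ge1$ be an integer. If $G$ is a finite simple graph of order $n$ with complement $\overline{G}$, then $$d_R^k(G)+d_R^k(\overline{G})\le n+4k-2,$$ with equality only for graphs with $\Delta(G)-\delta(G)=1$.
   Context: $\Delta(G)$ and $\delta(G)$ denote the maximum and minimum degree of $G$. Let $k\ge1$ be an integer. A Roman $k$-dominating function (RkDF) on a graph $G$ is a map $f:V(G)\to\{0,1,2\}$ such that every vertex $v$ with $f(v)=0$ has at least $k$ neighbors $u$ with $f(u)=2$. A set $\{f_1,\ldots,f_d\}$ of pairwise distinct RkDFs on $G$ with $\sum_{i=1}^d f_i(v)\le 2k$ for every $v\in V(G)$ is a Roman $(k,k)$-dominating family on $G$; the maximum number of functions in such a family is the Roman $(k,k)$-domatic number $d_R^k(G)$. *)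

(* Defs.v *)
From mathcomp Require Import all_boot.
Set Implicit Arguments.
Unset Strict Implicit.
Unset Printing Implicit Defensive.

Record sgraph := SGraph {
  vertex :> finType;
  adj : rel vertex;
  adj_sym : symmetric adj;
  adj_irr : irreflexive adj
}.

Section Complement.
Variable G : sgraph.

Definition co_adj : rel G := [rel x y | (x != y) && ~~ adj x y].

Lemma co_adj_sym : symmetric co_adj.
Proof. by move=> x y; rewrite /co_adj /= eq_sym adj_sym. Qed.

Lemma co_adj_irr : irreflexive co_adj.
Proof. by move=> x; rewrite /co_adj /= eqxx. Qed.

Definition compl : sgraph := SGraph co_adj_sym co_adj_irr.
End Complement.

Definition order_of (G : sgraph) : nat := #|vertex G|.

Definition degree (G : sgraph) (v : G) : nat := #|[set u : G | adj v u]|.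

Definition max_degree (G : sgraph) : nat := \max_(v : G) degree v.

(* Every degree is smaller than the order, so the default value of the [minn]
   is never attained when G has a vertex. *)
Definition min_degree (G : sgraph) : nat :=
  \big[minn/order_of G]_(v : G) degree v.

Definition roman_dominating (k : nat) (G : sgraph) (f : {ffun G -> 'I_3}) : bool :=
  [forall v : G, (f v == 0 :> nat) ==>
     (k <= #|[set u : G | adj v u && (f u == 2 :> nat)]|)].

(* Families are sets of functions, so their members are pairwise distinct. *)
Definition roman_dominating_family (k : nat) (G : sgraph)
    (F : {set {ffun G -> 'I_3}}) : bool :=
  [forall f in F, roman_dominating k f] &&
  [forall v : G, \sum_(f in F) (f v : nat) <= 2 * k].

Definition roman_domatic (k : nat) (G : sgraph) : nat :=
  \max_(F : {set {ffun G -> 'I_3}} | roman_dominating_family k F) #|F|.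

(* Main.v *)
(** Let [F] be a family and [v] a vertex. Each member vanishing at [v] puts
    weight at least [2k] on the neighbours of [v], which carry total weight at
    most [2k * degree v]; so at most [degree v] members vanish at [v]. The others
    have total weight at most [2k] at [v], hence
    [#|F| + #{f in F | f v = 2} <= degree v + 2k]. Taking [v] of minimum degree in
    [G], and of maximum degree for the complement, bounds the sum by
    [n - 1 - (Delta - delta) + 4k]. If [G] is regular, equality
    [#|F| = degree v + 2k] would hold at every vertex, so no member takes the
    value 2, hence none takes the value 0, and [F] has at most one member, the
    constant 1: contradiction. Both terms then lose at least one. *)
Require Import Defs.
From mathcomp Require Import all_boot zify.

Set Implicit Arguments.
Unset Strict Implicit.
Unset Printing Implicit Defensive.

Section BigMin.
Variables (I : eqType) (x : nat) (E : I -> nat).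

Lemma bigminn_leq (s : seq I) (j : I) :
  j \in s -> \big[minn/x]_(i <- s) E i <= E j.
Proof.
elim: s => // a s IHs; rewrite inE big_cons => /orP[/eqP-> | /IHs le_sj].
  exact: geq_minl.
exact: leq_trans (geq_minr _ _) le_sj.
Qed.

End BigMin.

Section Degrees.
Variable G : sgraph.

Lemma degree_ltn (v : G) : degree v < order_of G.
Proof.
rewrite /degree /order_of -cardsT; apply/proper_card/properP.
by split; [exact: subsetT | exists v; rewrite ?inE // adj_irr].
Qed.

Lemma degree_compl (v : G) :
  @degree (compl G) v + degree v = (order_of G).-1.
Proof.
rewrite /degree /order_of -(cardsC1 v).
rewrite -(cardsID [set u | adj v u] [set~ v]) addnC.
congr (_ + _); apply: eq_card => u; rewrite !inE.
  by case: eqVneq => //= ->; rewrite adj_irr.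
by rewrite /= eq_sym andbC.
Qed.

Lemma degree_leq_max (v : G) : degree v <= max_degree G.
Proof. exact: leq_bigmax. Qed.

Lemma min_degree_leq (v : G) : min_degree G <= degree v.
Proof. by apply: bigminn_leq; rewrite mem_index_enum. Qed.

Lemma max_degree_attained :
  0 < order_of G -> exists v : G, max_degree G = degree v.
Proof. by case/(eq_bigmax (@degree G)) => v; exists v. Qed.

Lemma min_degree_attained :
  0 < order_of G -> exists v : G, min_degree G = degree v.
Proof.
case/card_gt0P=> v0 _.
case: (@arg_minnP _ v0 predT (@degree G)) => // v _ vmin.
exists v; apply/eqP; rewrite eqn_leq min_degree_leq /=.
(* The default [order_of G] has to be bounded below too; it exceeds every degree. *)
apply: (big_ind (leq (degree v))) => [|x y|u _].
- exact: ltnW (degree_ltn v).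
- by rewrite leq_min => -> ->.
- exact: vmin.
Qed.

End Degrees.

Section Families.
Variables (k : nat) (G : sgraph).
Implicit Types (f : {ffun G -> 'I_3}) (F : {set {ffun G -> 'I_3}}) (v : G).

Lemma roman_dominating_neighbourhood_weight f v :
  roman_dominating k f -> f v = 0 :> nat ->
  2 * k <= \sum_(u | adj v u) f u.
Proof.
move=> /forallP/(_ v)/implyP domf /eqP/domf le_k.
rewrite (leq_trans (n := 2 * #|[set u | adj v u & f u == 2 :> nat]|)) //.
  by rewrite leq_mul2l.
rewrite -sum1_card big_distrr /= big_mkcond [X in _ <= X]big_mkcond /=.
by apply: leq_sum => u _; rewrite inE; case: (adj v u) => //=; case: eqP => // ->.
Qed.

Lemma card_vanishing_leq_degree F v :
  0 < k -> roman_dominating_family k F ->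
  #|[set f in F | f v == 0 :> nat]| <= degree v.
Proof.
move=> hk /andP[/forall_inP domF /forallP sumF].
rewrite -(@leq_pmul2r (2 * k)) ?muln_gt0 //.
(* Double counting: the weight around [v] is summed by member, then, after [exchange_big], by
   neighbour. *)
apply: (@leq_trans (\sum_(f in F) \sum_(u | adj v u) f u)).
  rewrite -sum1_card big_distrl /= big_mkcond [X in _ <= X]big_mkcond /=.
  apply: leq_sum => f _; rewrite inE; case: (boolP (f \in F)) => //= fF.
  case: eqP => // fv0; rewrite mul1n.
  exact: roman_dominating_neighbourhood_weight (domF f fF) fv0.
rewrite exchange_big /= /degree cardsE -sum1_card big_distrl /=.
by apply: leq_sum => u _; rewrite mul1n.
Qed.

Lemma card_family_leq F v :
  0 < k -> roman_dominating_family k F ->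
  #|F| + #|[set f in F | f v == 2 :> nat]| <= degree v + 2 * k.
Proof.
move=> hk famF; have /andP[_ /forallP/(_ v) sumF] := famF.
(* Each member [f] satisfies [1 + [f v = 2] = [f v = 0] + f v], whichever of the three values it
   takes. *)
apply: leq_trans (leq_add (card_vanishing_leq_degree v hk famF) sumF).
rewrite -!sum1_card [X in _ + X]big_mkcond /=.
rewrite big_mkcond [\sum_(f in [set _ in _ | _]) 1]big_mkcond.
rewrite [X in _ <= _ + X]big_mkcond -!big_split /=.
apply: leq_sum => f _; rewrite !inE; case: (f \in F) => //=.
by case: (f v) => [[|[|[|]]]].
Qed.

Lemma roman_domatic_attained :
  exists2 F, @roman_dominating_family k G F & roman_domatic k G = #|F|.
Proof.
(* The empty family makes the range of the maximum nonempty, so that the maximum is attained. *)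
have fam0 : roman_dominating_family k (set0 : {set {ffun G -> 'I_3}}).
  apply/andP; split; first by apply/forall_inP=> f; rewrite inE.
  by apply/forallP=> v; rewrite big_set0.
have [|F famF eqF] := @eq_bigmax_cond _
  [pred F : {set {ffun G -> 'I_3}} | roman_dominating_family k F]
  (fun F => #|F|).
  by apply/card_gt0P; exists set0.
by exists F.
Qed.

Lemma roman_domatic_leq_degree v :
  0 < k -> roman_domatic k G <= degree v + 2 * k.
Proof.
move=> hk; have [F famF ->] := roman_domatic_attained.
exact: leq_trans (leq_addr _ _) (card_family_leq v hk famF).
Qed.

Lemma roman_domatic_regular r :
  0 < k -> 0 < order_of G -> (forall v, degree v = r) ->
  roman_domatic k G < r + 2 * k.
Proof.
move=> hk /card_gt0P[v0 _] regG; rewrite ltnNge; apply/negP.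
have [F famF ->] := roman_domatic_attained => leF.
have no2 f v : f \in F -> f v != 2 :> nat.
  move=> fF; apply/negP=> fv2.
  have := card_family_leq v hk famF; rewrite regG.
  suff : 0 < #|[set f in F | f v == 2 :> nat]| by lia.
  by apply/card_gt0P; exists f; rewrite inE fF.
have no0 f v : f \in F -> f v != 0 :> nat.
  move=> fF; have /andP[/forall_inP/(_ f fF)/forallP/(_ v)/implyP domf _] := famF.
  apply/negP=> /domf; rewrite leqNgt (_ : [set _ | _] = set0) ?cards0 ?hk //.
  by apply/setP=> u; rewrite !inE (negPf (no2 f u fF)) andbF.
have : #|F| <= 1.
  apply/card_le1_eqP=> f g fF gF; apply/ffunP=> v; apply/val_inj => /=.
  have := (no0 f v fF, no2 f v fF, no0 g v gF, no2 g v gF).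
  by case: (f v) (g v) => [[|[|[|]]] // ?] [[|[|[|]]] // ?] [[[]]].
(* A family of at most one member cannot reach [r + 2 * k], which is at least 2. *)
lia.
Qed.

End Families.

Theorem theorem7 (k : nat) (hk : 1 <= k) (G : sgraph) (hG : 0 < order_of G) :
  roman_domatic k G + roman_domatic k (compl G) <= order_of G + 4 * k - 2
  /\ (roman_domatic k G + roman_domatic k (compl G) = order_of G + 4 * k - 2 ->
      max_degree G - min_degree G = 1).
Proof.
have [v eqv] := min_degree_attained hG.
have [w eqw] := max_degree_attained hG.
have [lt_mM | le_Mm] := ltnP (min_degree G) (max_degree G).
  (* The sum is at most [n - 1 - (Delta - delta) + 4k], so equality forces a gap of exactly 1. *)
  have := roman_domatic_leq_degree v hk.
  have := @roman_domatic_leq_degree k (compl G) w hk.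
  have := degree_compl w.
  lia.
have regG (u : G) : degree u = min_degree G.
  have := degree_leq_max u; have := min_degree_leq u; lia.
have regC (u : G) : @degree (compl G) u = (order_of G).-1 - min_degree G.
  by rewrite -(degree_compl u) regG addnK.
(* The two strict bounds give at most [n + 4k - 3], so equality is impossible here; [degree_ltn]
   keeps the subtraction in [regC] from truncating. *)
have := roman_domatic_regular hk hG regG.
have := @roman_domatic_regular k (compl G) _ hk hG regC.
have := degree_ltn v.
lia.
Qed.
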